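(* For every integer $n$ the following identities hold: \[ v_{2n}=u_nv_{n+1}+(u_{n+1}-ru_n)v_n+tu_{n-1}v_{n-1}, \] \[ 2v_{3n} = 6t^n - v_n^3 + 3u_n v_nv_{n+1} + 3(u_{n + 1} - ru_n )v_n^2 + 3tu_{n - 1} v_{n - 1} v_n, \] \[ \begin{split} 2v_{4n} &= 2(u_{n + 1} - ru_n )v_n^3 + \bigl(2tu_{n - 1} v_{n - 1} + (u_{n + 1} - ru_n )^2 + 2u_n v_{n + 1} \bigr)v_n^2\\ &\quad+ 2\bigl((u_{n + 1} - ru_n )u_n v_{n + 1} + 4t^n + tu_{n - 1} v_{n - 1} (u_{n + 1} - ru_n )\bigr)v_n\\ &\quad+ t^2 u_{n - 1}^2 v_{n - 1}^2 + 2tu_n v_{n + 1} u_{n - 1} v_{n - 1} + u_n^2 v_{n + 1}^2 - v_n^4. \end{split} \]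
   Context: Let $r,s,t$ be complex numbers with $t\neq 0$. For complex $a,b,c$ the sequence $(w_n)=(w_n(a,b,c;r,s,t))$ is defined by $w_0=a$, $w_1=b$, $w_2=c$ and $w_n=rw_{n-1}+sw_{n-2}+tw_{n-3}$ for $n\ge 3$, and is extended to negative indices by $w_{-n}=(w_{-(n-3)}-rw_{-(n-2)}-sw_{-(n-1)})/t$, so that the recurrence holds for all integer indices. Put $u_n=w_n(0,1,r;r,s,t)$ and $v_n=w_n(3,r,r^2+2s;r,s,t)$ for all integers $n$. Standing assumption: the three zeros $\alpha,\beta,\gamma$ of $x^3-rx^2-sx-t$ in $\mathbb{C}$ are distinct (so $v_n=\alpha^n+\beta^n+\gamma^n$). *)

(* Defs.v *)
From HB Require Import structures.
From mathcomp Require Import all_boot all_order all_algebra.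
From mathcomp Require Import ring.
From mathcomp Require Import complex reals.
Set Implicit Arguments.
Unset Strict Implicit.
Unset Printing Implicit Defensive.
Import Order.TTheory GRing.Theory Num.Theory.
Local Open Scope ring_scope.

Section Tribonacci.
Context {F : fieldType}.
Implicit Types (a b c r s t : F) (n : int).

Fixpoint tribo_pos a b c r s t (m : nat) {struct m} : F :=
  match m with
  | 0 => a
  | 1 => b
  | 2 => c
  | ((m3.+1 as m2).+1 as m1).+1 =>
      r * tribo_pos a b c r s t m1 + s * tribo_pos a b c r s t m2
      + t * tribo_pos a b c r s t m3
  end.

(* [tribo_neg a b c r s t m] is the term of index [- m]. *)
Fixpoint tribo_neg a b c r s t (m : nat) {struct m} : F :=
  match m with
  | 0 => a
  | 1 => (c - r * b - s * a) / t
  | (0.+1 as m1).+1 => (b - r * a - s * tribo_neg a b c r s t m1) / t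
  | ((m3.+1 as m2).+1 as m1).+1 =>
      (tribo_neg a b c r s t m3 - r * tribo_neg a b c r s t m2
       - s * tribo_neg a b c r s t m1) / t
  end.

Definition tribo a b c r s t n : F :=
  match n with
  | Posz m => tribo_pos a b c r s t m
  | Negz m => tribo_neg a b c r s t m.+1
  end.

Definition tribo_u r s t n : F := tribo 0 1 r r s t n.

Definition tribo_v r s t n : F := tribo 3 r (r ^+ 2 + 2 * s) r s t n.

Definition tribo_charpoly r s t : {poly F} :=
  'X^3 - r *: 'X^2 - s *: 'X - t%:P.

Lemma triboE a b c r s t n : t != 0 ->
  tribo a b c r s t n =
    r * tribo a b c r s t (n - 1) + s * tribo a b c r s t (n - 2)
    + t * tribo a b c r s t (n - 3).
Proof.
move=> t0; case: n => [[|[|[|m]]]|m].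
- have -> : 0%:Z - 1 = Negz 0 by [].
  have -> : 0%:Z - 2 = Negz 1 by [].
  have -> : 0%:Z - 3 = Negz 2 by [].
  by rewrite /tribo; cbn [tribo_pos tribo_neg]; field.
- have -> : 1%:Z - 1 = Posz 0 by [].
  have -> : 1%:Z - 2 = Negz 0 by [].
  have -> : 1%:Z - 3 = Negz 1 by [].
  by rewrite /tribo; cbn [tribo_pos tribo_neg]; field.
- have -> : 2%:Z - 1 = Posz 1 by [].
  have -> : 2%:Z - 2 = Posz 0 by [].
  have -> : 2%:Z - 3 = Negz 0 by [].
  by rewrite /tribo; cbn [tribo_pos tribo_neg]; field.
- have -> : Posz m.+3 - 1 = Posz m.+2 by rewrite -[m.+3]addn1 PoszD addrK.
  have -> : Posz m.+3 - 2 = Posz m.+1 by rewrite -[m.+3]addn2 PoszD addrK.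
  have -> : Posz m.+3 - 3 = Posz m by rewrite -[m.+3]addn3 PoszD addrK.
  by [].
- have -> : Negz m - 1 = Negz m.+1 by rewrite !NegzE -opprD -PoszD addn1.
  have -> : Negz m - 2 = Negz m.+2 by rewrite !NegzE -opprD -PoszD addn2.
  have -> : Negz m - 3 = Negz m.+3 by rewrite !NegzE -opprD -PoszD addn3.
  by case: m => [|m]; rewrite /tribo; cbn [tribo_pos tribo_neg]; field.
Qed.

End Tribonacci.

(* Main.v *)
(** By uniqueness of solutions of the recurrence, [v n] is the power sum
    [alpha ^ n + beta ^ n + gamma ^ n], and each root satisfies
    [x ^ n = u n * x + (u (n + 1) - r * u n) + t * u (n - 1) / x].  Multiplying
    the latter by [x ^ n] and summing over the roots gives the formula for
    [v (2 * n)].  The other two are Newton's identities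
    [2 p3 = 6 e3 - p1^3 + 3 p1 p2] and
    [2 p4 = p2^2 + 2 p1^2 p2 - p1^4 + 8 e3 p1] for the numbers [alpha ^ n],
    [beta ^ n], [gamma ^ n], whose product is [t ^ n]. *)
Require Import Defs.
From mathcomp Require Import all_boot all_order all_algebra.
From mathcomp Require Import ring.
From mathcomp Require Import complex reals.
Import Order.TTheory GRing.Theory Num.Theory.
Local Open Scope ring_scope.

Definition linrec3 {F : fieldType} (r s t : F) (f : int -> F) :=
  forall n, f (n + 3) = r * f (n + 2) + s * f (n + 1) + t * f n.

Section Recurrence.
Context {F : fieldType}.
Implicit Types (r s t x : F) (n : int) (f g : int -> F).

(** Three consecutive values determine their successor by the recurrence, and their predecessor
    because [t] is invertible. The induction on integers therefore carries agreement at [n], [n + 1]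
    and [n + 2] together. *)
Lemma linrec3_uniq r s t f g : t != 0 -> linrec3 r s t f -> linrec3 r s t g ->
  f 0 = g 0 -> f 1 = g 1 -> f 2 = g 2 -> f =1 g.
Proof.
move=> t0 recf recg fg0 fg1 fg2 n.
suff [] : [/\ f n = g n, f (n + 1) = g (n + 1) & f (n + 2) = g (n + 2)] by [].
elim: n => [//|n [fgn fgn1 fgn2]|n [fgn fgn1 fgn2]].
- have -> : n.+1%:Z = n%:Z + 1 by rewrite -addn1 PoszD.
  have -> : n%:Z + 1 + 1 = n%:Z + 2 by ring.
  have -> : n%:Z + 1 + 2 = n%:Z + 3 by ring.
  by split => //; rewrite recf recg fgn fgn1 fgn2.
- have [m En] : exists m, - n%:Z = m + 1 by exists (- n%:Z - 1); ring.
  have -> : - n.+1%:Z = m by rewrite -addn1 PoszD opprD En addrK.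
  move: fgn fgn1 fgn2; rewrite En.
  have -> : m + 1 + 1 = m + 2 by ring.
  have -> : m + 1 + 2 = m + 3 by ring.
  move=> fg1' fg2' fg3'; split => //.
  apply: (mulfI t0); apply: (addrI (r * f (m + 2) + s * f (m + 1))).
  by rewrite -recf fg3' recg fg1' fg2'.
Qed.

Lemma tribo_linrec3 a b c r s t : t != 0 -> linrec3 r s t (tribo a b c r s t).
Proof.
move=> t0 n; rewrite [LHS]triboE //.
have -> : n + 3 - 1 = n + 2 by ring.
have -> : n + 3 - 2 = n + 1 by ring.
by rewrite addrK.
Qed.

Lemma root_tribo_charpoly r s t x : root (tribo_charpoly r s t) x ->
  x ^+ 3 = r * x ^+ 2 + s * x + t.
Proof.
rewrite /root /tribo_charpoly !hornerE => /eqP px.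
by apply/eqP; rewrite -subr_eq0 -px; apply/eqP; ring.
Qed.

Lemma exprz_linrec3 r s t x : x != 0 -> x ^+ 3 = r * x ^+ 2 + s * x + t ->
  linrec3 r s t (exprz x).
Proof.
move=> x0 x3 n; rewrite !expfzDr // !expr1z.
by transitivity (x ^ n * x ^+ 3); [ring | rewrite x3; ring].
Qed.

(** As functions of [n] both sides satisfy the recurrence, so comparing them at 0, 1 and 2
    suffices. *)
Lemma exprz_tribo_u r s t x n : t != 0 -> x != 0 ->
    x ^+ 3 = r * x ^+ 2 + s * x + t ->
  x ^ n = tribo_u r s t n * x + (tribo_u r s t (n + 1) - r * tribo_u r s t n)
          + t * tribo_u r s t (n - 1) / x.
Proof.
move=> t0 x0 x3; set u := tribo_u r s t.
have recu : linrec3 r s t u by exact: tribo_linrec3.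
(* The comparison at 0 involves [u (-1)]. The recurrence starting at -1 reads
   [r = r * 1 + s * 0 + t * u (-1)]. *)
have um1 : u (-1) = 0.
  apply: (mulfI t0); rewrite mulr0.
  have := recu (-1); rewrite -[-1 + 3]/2%:Z -[-1 + 2]/1%:Z -[-1 + 1]/0%:Z.
  rewrite /u /tribo_u /=; move/eqP; rewrite -subr_eq0 => /eqP E.
  by apply/eqP; rewrite -oppr_eq0 -E; apply/eqP; ring.
pose g n := u n * x + (u (n + 1) - r * u n) + t * u (n - 1) / x.
apply: (linrec3_uniq r s t (exprz x) g) => // [||||].
- exact: exprz_linrec3.
- move=> m; rewrite /g.
  have -> : m + 3 + 1 = m + 1 + 3 by ring.
  have -> : m + 3 - 1 = m - 1 + 3 by ring.
  rewrite !recu.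
  have -> : m - 1 + 2 = m + 1 by ring.
  have -> : m - 1 + 1 = m by ring.
  have -> : m + 2 + 1 = m + 1 + 2 by ring.
  have -> : m + 2 - 1 = m + 1 by ring.
  have -> : m + 1 - 1 = m by ring.
  by field.
- by rewrite /g sub0r um1 add0r /u /tribo_u /=; field.
- by rewrite /g subrr /u /tribo_u /= expr1z; field.
(* Here [u 3] is unfolded to [r * r + s * 1 + t * 0], so [g 2] is [r * x + s + t / x]; multiplying
   by [x] gives the cubic equation. *)
- have -> : g 2 = x * r + (r * r + s * 1 + t * 0 - r * r) + t * 1 / x.
    by rewrite /g /u /tribo_u /=; ring.
  by apply: (mulfI x0); rewrite -exprSz -[x ^ 3%R]/(x ^+ 3) x3; field.
Qed.

Lemma vieta3 r s t x y z : uniq [:: x; y; z] ->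
    x ^+ 3 = r * x ^+ 2 + s * x + t -> y ^+ 3 = r * y ^+ 2 + s * y + t ->
    z ^+ 3 = r * z ^+ 2 + s * z + t ->
  [/\ r = x + y + z, s = - (x * y + y * z + z * x) & t = x * y * z].
Proof.
rewrite /= !inE negb_or andbT => /andP[/andP[xy xz] yz] x3 y3 z3.
(* Subtract the cubic equations of two distinct roots and divide by [p - q]. *)
have quad p q : p != q -> p ^+ 3 = r * p ^+ 2 + s * p + t ->
    q ^+ 3 = r * q ^+ 2 + s * q + t ->
    s = p ^+ 2 + p * q + q ^+ 2 - r * (p + q).
  move=> pq p3 q3; have pq0 : p - q != 0 by rewrite subr_eq0.
  apply: (mulfI pq0); transitivity ((p ^+ 3 - q ^+ 3) - r * (p ^+ 2 - q ^+ 2)).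
    by rewrite p3 q3; ring.
  by ring.
have sxy := quad _ _ xy x3 y3; have sxz := quad _ _ xz x3 z3.
have rE : r = x + y + z.
  have yz0 : y - z != 0 by rewrite subr_eq0.
  apply: (mulfI yz0); apply/eqP; rewrite -subr_eq0; apply/eqP.
  (* The two expressions for [s] differ by [(y - z) * (x + y + z - r)]. *)
  by move/eqP: (sxy); rewrite {1}sxz -subr_eq0 => /eqP <-; ring.
have sE : s = - (x * y + y * z + z * x) by rewrite sxy rE; ring.
split => //.
transitivity (x ^+ 3 - r * x ^+ 2 - s * x); first by rewrite x3; ring.
by rewrite sE rE; ring.
Qed.

(** With the coefficients written as symmetric functions, the initial values 3, [r] and
    [r ^+ 2 + 2 * s] are the power sums of exponents 0, 1 and 2. *)
Lemma tribo_v_power_sum x y z n :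
  let r := x + y + z in let s := - (x * y + y * z + z * x) in
  let t := x * y * z in
  t != 0 -> tribo_v r s t n = x ^ n + y ^ n + z ^ n.
Proof.
move=> r s t t0.
have [x0 y0 z0] : [/\ x != 0, y != 0 & z != 0].
  by move: t0; rewrite /t !mulf_eq0 !negb_or => /andP[/andP[]].
have rec p : p != 0 -> (p - x) * (p - y) * (p - z) = 0 ->
    linrec3 r s t (exprz p).
  move=> p0 E; apply: exprz_linrec3 => //; apply/eqP; rewrite -subr_eq0 -E.
  by apply/eqP; rewrite /r /s /t; ring.
apply: (linrec3_uniq r s t (tribo_v r s t)
  (fun n => x ^ n + y ^ n + z ^ n)) => //.
- exact: tribo_linrec3.
- move=> m; rewrite !rec ?subrr ?mul0r ?mulr0 //; first by ring.
  by rewrite mul0r.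
- by rewrite !expr0z /tribo_v /=; ring.
- rewrite /tribo_v /= -![_ ^ 2]/(_ ^+ 2) /r /s; ring.
Qed.

End Recurrence.

Theorem theorem10 (R : realType) (r s t : R[i]) (ht : t != 0)
    (alpha beta gamma : R[i])
    (hroots : all (root (tribo_charpoly r s t)) [:: alpha; beta; gamma])
    (hdistinct : uniq [:: alpha; beta; gamma])
    (n : int) :
  let u := tribo_u r s t in
  let v := tribo_v r s t in
  [/\ v (2 * n) =
        u n * v (n + 1) + (u (n + 1) - r * u n) * v n
        + t * u (n - 1) * v (n - 1),
      2 * v (3 * n) =
        6 * t ^ n - v n ^+ 3 + 3 * u n * v n * v (n + 1)
        + 3 * (u (n + 1) - r * u n) * v n ^+ 2
        + 3 * t * u (n - 1) * v (n - 1) * v n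
    & 2 * v (4 * n) =
        2 * (u (n + 1) - r * u n) * v n ^+ 3
        + (2 * t * u (n - 1) * v (n - 1) + (u (n + 1) - r * u n) ^+ 2
           + 2 * u n * v (n + 1)) * v n ^+ 2
        + 2 * ((u (n + 1) - r * u n) * u n * v (n + 1) + 4 * t ^ n
               + t * u (n - 1) * v (n - 1) * (u (n + 1) - r * u n)) * v n
        + t ^+ 2 * u (n - 1) ^+ 2 * v (n - 1) ^+ 2
        + 2 * t * u n * v (n + 1) * u (n - 1) * v (n - 1)
        + u n ^+ 2 * v (n + 1) ^+ 2 - v n ^+ 4].
Proof.
move=> u v.
move: hroots => /= /and4P[/root_tribo_charpoly x3 /root_tribo_charpoly y3
  /root_tribo_charpoly z3 _].
have [rE sE tE] := vieta3 _ _ _ _ _ _ hdistinct x3 y3 z3.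
have [x0 y0 z0] : [/\ alpha != 0, beta != 0 & gamma != 0].
  by move: ht; rewrite tE !mulf_eq0 !negb_or => /andP[/andP[]].
have vE m : v m = alpha ^ m + beta ^ m + gamma ^ m.
  by rewrite /v rE sE tE tribo_v_power_sum // -tE.
have v2n : v (2 * n) = u n * v (n + 1) + (u (n + 1) - r * u n) * v n
                       + t * u (n - 1) * v (n - 1).
  have dbl x : x != 0 -> x ^+ 3 = r * x ^+ 2 + s * x + t ->
      x ^ (2 * n) = u n * x ^ (n + 1) + (u (n + 1) - r * u n) * x ^ n
                    + t * u (n - 1) * x ^ (n - 1).
    move=> xn0 xE; have -> : 2 * n = n + n by ring.
    (* Only one factor of [x ^ n * x ^ n] is expanded; the other raises each exponent by [n]. *)
    rewrite !expfzDr // {2}(exprz_tribo_u r s t x n ht xn0 xE) -/u.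
    by rewrite expr1z exprN1; ring.
  by rewrite !vE (dbl _ x0 x3) (dbl _ y0 y3) (dbl _ z0 z3); ring.
have tn : t ^ n = alpha ^ n * beta ^ n * gamma ^ n.
  by rewrite tE !exprzMl ?unitfE ?mulf_neq0.
have powM x (k : nat) : x ^ (k%:Z * n) = (x ^ n) ^+ k.
  by rewrite mulrC -exprz_exp.
have p2 : v (2 * n) = (alpha ^ n) ^+ 2 + (beta ^ n) ^+ 2 + (gamma ^ n) ^+ 2.
  by rewrite vE !powM.
split => //.
(* Newton's identity with [p1 = v n], [p2 = v (2 * n)] and [e3 = t ^ n]; the formula for [v (2 * n)]
   turns it into the claim. The last case goes the same way. *)
- transitivity (6 * t ^ n - v n ^+ 3 + 3 * v n * v (2 * n)); last first.
    by rewrite v2n; ring.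
  by rewrite p2 !vE !powM tn; ring.
- transitivity (v (2 * n) ^+ 2 + 2 * v n ^+ 2 * v (2 * n) - v n ^+ 4
                + 8 * t ^ n * v n); last by rewrite v2n; ring.
  by rewrite p2 !vE !powM tn; ring.
Qed.
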